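(* Suppose there exists $\tilde\omega\in(-\infty,-\lambda_0(\Omega))$ such that $\mathcal{I}(\tilde\omega)\setminus\mathcal{N}_{\Omega,\tilde\omega}\neq\emptyset$. Then for any $m\in\mathcal{I}(\tilde\omega)\setminus\mathcal{N}_{\Omega,\tilde\omega}$, an energy ground state with mass $m$ is not an action ground state for any $\omega$; that is, if $\phi\in\mathcal{B}_{\Omega,m}$ then $\phi\notin\mathcal{A}_{\Omega,\omega}$ for every $\omega$.
   Context: Let $d\ge 2$, let $1<p<\infty$ if $d=2$ and $1<p<\frac{d+2}{d-2}$ if $d\ge 3$. Let $V:\mathbb{R}^d\to\mathbb{R}$ satisfy $V\ge 0$ and $\lim_{|\mathbf{x}|\to\infty}V(\mathbf{x})=\infty$. Let $\Omega_{\max}:=\sup\{\gamma\ge 0:\lim_{|\mathbf{x}|\to\infty}(V(\mathbf{x})-\frac{\gamma^2}{2}(x_1^2+x_2^2))=\infty\}$, assume $\Omega_{\max}>0$, and fix $0<\Omega<\Omega_{\max}$. Let $L_z=i(x_2\partial_{x_1}-x_1\partial_{x_2})$. Let $X$ be the space of complex-valued $\phi\in H^1(\mathbb{R}^d)$ with $\int_{\mathbb{R}^d}V|\phi|^2\,d\mathbf{x}<\infty$, with norm $\|\phi\|_X^2=\int_{\mathbb{R}^d}\big(|\nabla\phi|^2+(1+V)|\phi|^2\big)d\mathbf{x}$. For $\phi\in X$ the quantity $\int_{\mathbb{R}^d}\overline{\phi}L_z\phi\,d\mathbf{x}$ is well defined and real. Define the energy $E(\phi)=\frac12\|\nabla\phi\|_{L^2}^2+\int_{\mathbb{R}^d}V|\phi|^2\,d\mathbf{x}+\frac{2}{p+1}\|\phi\|_{L^{p+1}}^{p+1}-\Omega\int_{\mathbb{R}^d}\overline{\phi}L_z\phi\,d\mathbf{x}$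 and the action $S_{\Omega,\omega}(\phi)=E(\phi)+\omega\|\phi\|_{L^2}^2$. Let $\lambda_0(\Omega)=\inf_{0\ne\phi\in X}\frac{\int_{\mathbb{R}^d}(\frac12|\nabla\phi|^2+V|\phi|^2-\Omega\overline{\phi}L_z\phi)d\mathbf{x}}{\|\phi\|_{L^2}^2}$. An action ground state associated with $\omega$ (and $\Omega$) is an element of $\mathcal{A}_{\Omega,\omega}:=\arg\min_{\phi\in X}S_{\Omega,\omega}(\phi)$; it is known that for $\omega<-\lambda_0(\Omega)$ this set is nonempty, that $\min_X S_{\Omega,\omega}<0$, and that it coincides with the set of minimizers of $S_{\Omega,\omega}$ over all nontrivial solutions of $-\frac12\Delta\phi+V\phi+|\phi|^{p-1}\phi-\Omega L_z\phi+\omega\phi=0$. For $m>0$, an energy ground state with mass $m$ is an element of $\mathcal{B}_{\Omega,m}:=\arg\min\{E(\phi):\phi\in X,\ \|\phi\|_{L^2}^2=m\}$. For $\omega<-\lambda_0(\Omega)$ put $\mathcal{N}_{\Omega,\omega}:=\{\|\phi\|_{L^2}^2:\phi\in\mathcal{A}_{\Omega,\omega}\}$, $m^\ast(\omega):=\sup\mathcal{N}_{\Omega,\omega}$, $m_\ast(\omega):=\inf\mathcal{N}_{\Omega,\omega}$ and $\mathcal{I}(\omega):=[m_\ast(\omega),m^\ast(\omega)]$. *)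

(* Defs.v *)
From HB Require Import structures.
From mathcomp Require Import all_boot all_order all_algebra.
From mathcomp Require Import all_classical all_reals all_analysis.
From mathcomp Require Import complex.

Set Implicit Arguments.
Unset Strict Implicit.
Unset Printing Implicit Defensive.

Import Order.TTheory GRing.Theory Num.Theory.
Import numFieldNormedType.Exports.

Local Open Scope classical_set_scope.
Local Open Scope ring_scope.

(* The library puts no sigma-algebra on row vectors.  We use the one generated
   by the coordinates, i.e. the Borel sigma-algebra of R^n. *)
Definition row_display : measure_display.
Proof. exact: default_measure_display. Qed.

Section row_measurable.
Context {R : realType} (n : nat).

Definition row_coor (i : 'I_n) (x : 'rV[R]_n) : measurableTypeR R := x ord0 i.

Let row_set0 : g_sigma_preimage row_coor set0.
Proof. exact: sigma_algebra0. Qed.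

Let row_setC A : g_sigma_preimage row_coor A -> g_sigma_preimage row_coor (~` A).
Proof. exact: sigma_algebraC. Qed.

Let row_bigcup (F : (set 'rV[R]_n)^nat) :
  (forall i, g_sigma_preimage row_coor (F i)) ->
  g_sigma_preimage row_coor (\bigcup_i (F i)).
Proof. exact: sigma_algebra_bigcup. Qed.

HB.instance Definition _ := @isMeasurable.Build row_display
  'rV[R]_n (g_sigma_preimage row_coor) row_set0 row_setC row_bigcup.

Lemma measurable_row_coor (i : 'I_n) : measurable_fun setT (row_coor i).
Proof.
move=> _ Y mY; rewrite setTI; apply: sub_sigma_algebra => /=.
rewrite -bigcup_seq/=; exists i => /=; first by rewrite mem_index_enum.
by exists Y => //; rewrite setTI.
Qed.

Lemma measurable_fun_row d (T : measurableType d) (f : T -> 'rV[R]_n) :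
  (forall i, measurable_fun setT (row_coor i \o f)) -> measurable_fun setT f.
Proof.
move=> mf _ A mA; rewrite setTI.
suff: g_sigma_preimage row_coor `<=` [set B | measurable (f @^-1` B)].
  by apply.
apply: smallest_sub.
  split=> [|B mB|F mF] /=.
  - by rewrite preimage_set0; exact: measurable0.
  - by rewrite setTD preimage_setC; exact: measurableC.
  - by rewrite preimage_bigcup; exact: bigcupT_measurable.
move=> B; rewrite -bigcup_seq => -[i _ [C mC <-]] /=.
by have := mf i measurableT C mC; rewrite !setTI.
Qed.

End row_measurable.

Section row_lebesgue.
Context {R : realType}.

Definition row_cons n (z : measurableTypeR R * 'rV[R]_n) : 'rV[R]_n.+1 :=
  \row_i oapp (fun j => z.2 ord0 j) (z.1 : R) (unlift ord0 i).

Lemma measurable_row_cons n : measurable_fun setT (@row_cons n).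
Proof.
apply: measurable_fun_row => i.
case: (unliftP ord0 i) => [j ->|->].
  rewrite (_ : _ \o _ = row_coor j \o snd); last first.
    by apply/funext => z; rewrite /= /row_coor mxE liftK.
  by apply: measurableT_comp; [exact: measurable_row_coor|exact: measurable_snd].
rewrite (_ : _ \o _ = fst); last first.
  by apply/funext => z; rewrite /= /row_coor mxE unlift_none.
exact: measurable_fst.
Qed.

Definition row_uncons n (x : 'rV[R]_n.+1) : measurableTypeR R * 'rV[R]_n :=
  (x ord0 ord0, \row_j x ord0 (lift ord0 j)).

Lemma row_consK n : cancel (@row_cons n) (@row_uncons n).
Proof.
move=> [a y]; congr (_, _); first by rewrite mxE unlift_none.
by apply/rowP => j; rewrite !mxE liftK.
Qed.

Lemma measurable_row_uncons n : measurable_fun setT (@row_uncons n).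
Proof.
apply/measurable_fun_pairP; split; first exact: (measurable_row_coor ord0).
apply: measurable_fun_row => j.
rewrite (_ : _ \o _ = row_coor (lift ord0 j)); last first.
  by apply/funext => x; rewrite /= /row_coor mxE.
exact: measurable_row_coor.
Qed.

Section cons_measure.
Context (n : nat) (nu : {sigma_finite_measure set 'rV[R]_n -> \bar R}).

Definition cons_measure : set 'rV[R]_n.+1 -> \bar R :=
  pushforward (lebesgue_measure \x nu)%E (@row_cons n).

HB.instance Definition _ := Measure.copy cons_measure
  (measure_function_pushforward__canonical__measure_function_Measure
     (lebesgue_measure \x nu)%E (@measurable_row_cons n)).

Let cons_measure_sigma_finite : sigma_finite setT cons_measure.
Proof.
have /sigma_finiteP[F [TF ndF Foo]] :=
  sigma_finiteT (@lebesgue_measure R : {sigma_finite_measure set _ -> \bar R}).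
have /sigma_finiteP[G [TG ndG Goo]] := sigma_finiteT nu.
exists (fun k => @row_uncons n @^-1` (F k `*` G k)).
  rewrite -preimage_bigcup (_ : \bigcup_k _ = setT) ?preimage_setT//.
  apply/seteqP; split=> // -[x y] _.
  have [i _ Fx] : (\bigcup_i F i) x by rewrite -TF.
  have [j _ Gy] : (\bigcup_j G j) y by rewrite -TG.
  exists (maxn i j) => //; split=> /=.
  - by move: x Fx; exact/subsetPset/ndF/leq_maxl.
  - by move: y Gy; exact/subsetPset/ndG/leq_maxr.
move=> k; have [mF Fk] := Foo k; have [mG Gk] := Goo k; split.
  rewrite -[X in measurable X]setTI; apply: measurable_row_uncons => //.
  exact: measurableX.
have consK : @row_cons n @^-1` (@row_uncons n @^-1` (F k `*` G k)) = F k `*` G k.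
  by rewrite -comp_preimage (_ : _ \o _ = id)//; apply/funext => z; exact: row_consK.
rewrite /cons_measure /pushforward consK.
by rewrite product_measure1E// lte_mul_pinfty// ge0_fin_numE.
Qed.

HB.instance Definition _ := Measure_isSigmaFinite.Build _ _ _ cons_measure
  cons_measure_sigma_finite.

End cons_measure.

Fixpoint lebesgue_row n : {sigma_finite_measure set 'rV[R]_n -> \bar R} :=
  match n with
  | 0 => dirac (0 : 'rV[R]_0)
  | n'.+1 => cons_measure (lebesgue_row n')
  end.

End row_lebesgue.

Section complex_functions.
Context {R : realType} {d : nat}.
Local Notation Rd := 'rV[R]_d.
Local Notation mu := (@lebesgue_row R d).
Implicit Types (f : Rd -> R) (phi g : Rd -> R[i]).

Definition enorm (x : Rd) : R := Num.sqrt (\sum_i x ord0 i ^+ 2).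

Definition at_infinity : set_system Rd :=
  filter_from setT (fun r : R => [set x | r < enorm x]).

Definition cmeasurable phi : Prop :=
  measurable_fun setT (fun x => complex.Re (phi x)) /\
  measurable_fun setT (fun x => complex.Im (phi x)).

Definition cintegral phi : R[i] :=
  ((\int[mu]_x complex.Re (phi x)) +i* (\int[mu]_x complex.Im (phi x)))%C.

Definition cabs (z : R[i]) : R := ComplexField.Normc.normc z.

(* [Lpow q phi] is the q-th power of the L^q norm of phi *)
Definition Lpow (q : R) phi : \bar R :=
  \int[mu]_x (cabs (phi x) `^ q)%:E.

Definition L2 phi : Prop := cmeasurable phi /\ (Lpow 2 phi < +oo)%E.

Definition partial (j : 'I_d) f : Rd -> R := fun x => 'D_(delta_mx ord0 j) f x.

Fixpoint Ck (k : nat) f : Prop :=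
  continuous f /\
  match k with
  | 0 => True
  | k'.+1 => forall j : 'I_d,
      (forall x, derivable f x (delta_mx ord0 j)) /\ Ck k' (partial j f)
  end.

Definition test_function f : Prop :=
  (forall k, Ck k f) /\ compact (closure [set x | f x != 0]).

Definition weak_partial (j : 'I_d) phi g : Prop :=
  forall eta, test_function eta ->
    cintegral (fun x => (partial j eta x)%:C%C * phi x) =
    - cintegral (fun x => (eta x)%:C%C * g x).

Definition H1 phi : Prop :=
  L2 phi /\ forall j, exists g, L2 g /\ weak_partial j phi g.

(* A representative of the weak partial derivative, which is unique up to
   almost everywhere equality.  Its value is irrelevant outside H1. *)
Definition wpartial (j : 'I_d) phi : Rd -> R[i] :=
  xget (fun=> 0) [set g | L2 g /\ weak_partial j phi g].

(* |grad phi|^2 *)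
Definition grad2 phi (x : Rd) : R := \sum_j cabs (wpartial j phi x) ^+ 2.

End complex_functions.

Definition argmin (T : Type) (R : realType) (D : set T) (F : T -> \bar R) :
  set T := [set x | D x /\ forall y, D y -> (F x <= F y)%E].

Section rotating_nls.
Context {R : realType} (d : nat) (d_ge2 : (2 <= d)%N).
Local Notation Rd := 'rV[R]_d.
Local Notation mu := (@lebesgue_row R d).
Implicit Types (phi : Rd -> R[i]).

Definition i1 : 'I_d := Ordinal (ltnW d_ge2).
Definition i2 : 'I_d := Ordinal d_ge2.

Definition Lz phi (x : Rd) : R[i] :=
  'i%C * ((x ord0 i2)%:C%C * wpartial i1 phi x -
          (x ord0 i1)%:C%C * wpartial i2 phi x).

Variables (V : Rd -> R).

Definition Omega_max : \bar R :=
  ereal_sup [set gamma%:E | gamma in [set gamma : R | 0 <= gamma /\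
    V x - gamma ^+ 2 / 2 * (x ord0 i1 ^+ 2 + x ord0 i2 ^+ 2)
      @[x --> at_infinity] --> +oo]].

Definition potential phi : \bar R := \int[mu]_x (V x * cabs (phi x) ^+ 2)%:E.

Definition X : set (Rd -> R[i]) :=
  [set phi | H1 phi /\ (potential phi < +oo)%E].

Definition mass phi : \bar R := Lpow 2 phi.

Variables (Omega : R).

Definition lambda0 : \bar R :=
  ereal_inf [set (complex.Re (cintegral (fun x =>
      (2^-1 * grad2 phi x + V x * cabs (phi x) ^+ 2)%:C%C -
      Omega%:C%C * ((phi x)^*%C * Lz phi x))) / fine (mass phi))%:E
    | phi in [set phi | X phi /\ ~ {ae mu, forall x, phi x = 0}]].

Variables (p : R).

(* The first three terms are nonnegative extended reals, finite on X.  The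
   integral in the last one is a real number, so taking its real part does not
   change it. *)
Definition energy phi : \bar R :=
  ((2^-1)%:E * (\int[mu]_x (grad2 phi x)%:E) + potential phi +
   (2 / (p + 1))%:E * Lpow (p + 1) phi -
   (Omega * complex.Re (cintegral (fun x => (phi x)^*%C * Lz phi x)))%:E)%E.

Definition action (omega : R) phi : \bar R :=
  (energy phi + omega%:E * mass phi)%E.

Definition action_ground_state (omega : R) : set (Rd -> R[i]) :=
  argmin X (action omega).

Definition energy_ground_state (m : R) : set (Rd -> R[i]) :=
  argmin [set phi | X phi /\ mass phi = m%:E] energy.

Definition masses (omega : R) : set R :=
  [set m | exists2 phi, action_ground_state omega phi & mass phi = m%:E].

(* The mass is finite on X, so [masses omega] loses no value.  In the extended
   reals, the bounds below make sense whether or not [masses omega] is known to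
   be nonempty and bounded. *)
Definition mass_sup (omega : R) : \bar R := ereal_sup (EFin @` masses omega).
Definition mass_inf (omega : R) : \bar R := ereal_inf (EFin @` masses omega).

Definition mass_interval (omega : R) : set R :=
  [set m | (mass_inf omega <= m%:E <= mass_sup omega)%E].

End rotating_nls.

(* Main.v *)
Require Import Defs.
From mathcomp Require Import all_boot all_order all_algebra.
From mathcomp Require Import all_classical all_reals all_analysis.
From mathcomp Require Import complex.
From mathcomp Require Import lra.

Import Order.TTheory GRing.Theory Num.Theory.
Import numFieldNormedType.Exports.

Local Open Scope classical_set_scope.
Local Open Scope ring_scope.

(** The action [S_w = E + w * M] is affine in [w], so [w |-> min S_w] is a
    concave function, of which every minimizer of [S_w] with mass [m] gives a
    supporting line of slope [m] at [w].  Let [phi] minimize [S_w] and have a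
    mass [m] between the infimum and the supremum of the masses of the
    minimizers of [S_w0].  Slopes decrease with [w], so for [w < w0] the mass
    [m] can only be that supremum; but then the line of [phi] is a limit of
    supporting lines at [w0], hence touches the concave function at [w0] too,
    and [phi] itself minimizes [S_w0].  The case [w > w0] is the same with the
    infimum.  Thus [m] is attained at [w0], and a mass in the gap belongs to no
    action ground state, whatever its frequency.

    [argmin_transfer] is this argument for abstract functionals [E] and [M]; it
    applies because on [X] the energy is not [-oo] ([energy_neq_ninfty]) and the
    mass is finite ([mass_fin_num]). *)

(** The quantitative form of the limit of supporting lines: [phi] (energy [e],
    mass [m]) is compared at [w] with a minimizer at [w0] (energy [a], mass
    [k]), itself compared at [w0] with a competitor (energy [b], mass [n]).
    The error [(w0 - w) * (m - k)] becomes nonpositive or arbitrarily small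
    when [k] approaches the supremum of the masses if [w < w0], and their
    infimum if [w > w0]. *)
Lemma action_comparison (R : realType) (w w0 e m a k b n : R) :
  e + w * m <= a + w * k -> a + w0 * k <= b + w0 * n ->
  e + w0 * m <= b + w0 * n + (w0 - w) * (m - k).
Proof. by move=> h1 h2; nra. Qed.

(** The passage to the limit; the bound [`|c| * eps] on the slack allows
    [c = 0], that is, equal frequencies. *)
Lemma le_of_slack (R : realType) (c x y m : R) (P : set R) :
  (forall eps, 0 < eps -> exists2 k, P k & c * (m - k) <= `|c| * eps) ->
  (forall k, P k -> x <= y + c * (m - k)) -> x <= y.
Proof.
move=> near_m bound; apply/ler_addgt0Pr => eps eps_gt0.
have c1_gt0 : 0 < `|c| + 1 by rewrite ltr_wpDl.
have [k Pk kle] := near_m (eps / (`|c| + 1)) (divr_gt0 eps_gt0 c1_gt0).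
apply: le_trans (bound k Pk) _; rewrite lerD2l (le_trans kle)// mulrCA.
by rewrite ler_piMr ?(ltW eps_gt0)// ler_pdivrMr// mul1r lerDl ler01.
Qed.

(** The sign of [c] selects the end of the interval that provides [k]: for
    [c >= 0] an element of [P] above [m - eps], which exists since [m] is at
    most the supremum, and for [c < 0] one below [m + eps]. *)
Lemma interval_slack (R : realType) (P : set R) (c m : R) :
  (ereal_inf (EFin @` P) <= m%:E <= ereal_sup (EFin @` P))%E ->
  forall eps, 0 < eps -> exists2 k, P k & c * (m - k) <= `|c| * eps.
Proof.
move=> /andP[infm msup] eps eps_gt0; have [c_ge0|c_lt0] := leP 0 c.
  have /ereal_sup_gt[_ [k Pk <-]] : ((m - eps)%:E < ereal_sup (EFin @` P))%E.
    by apply: lt_le_trans msup; rewrite lte_fin ltrBlDr ltrDl.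
  rewrite lte_fin => mk; exists k => //.
  by rewrite ger0_norm// ler_wpM2l//; lra.
have /ereal_inf_lt[_ [k Pk <-]] : (ereal_inf (EFin @` P) < (m + eps)%:E)%E.
  by apply: le_lt_trans infm _; rewrite lte_fin ltrDl.
rewrite lte_fin => km; exists k => //.
by rewrite ltr0_norm//; nra.
Qed.

(** Both signs of [w0 - w] are treated at once, through [interval_slack].  The
    energy may take the value [+oo]: if [E phi = +oo] then [E] is [+oo] on all
    of [D] by minimality, and every element of [D] minimizes every action.  The
    comparison is thus only needed for a competitor [y] of finite energy, and
    then the minimizers it involves have finite energy too. *)
Lemma argmin_transfer (R : realType) (T : Type) (D : set T)
    (E M : T -> \bar R) (w w0 m : R) (phi : T) :
  (forall y, D y -> E y != -oo%E) ->
  (forall y, D y -> M y \is a fin_num) ->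
  let S (w : R) y := (E y + w%:E * M y)%E in
  let masses_at_w0 := [set k | exists2 y, argmin D (S w0) y & M y = k%:E] in
  argmin D (S w) phi -> M phi = m%:E ->
  (ereal_inf (EFin @` masses_at_w0) <= m%:E
     <= ereal_sup (EFin @` masses_at_w0))%E ->
  argmin D (S w0) phi.
Proof.
move=> E_ninfty M_fin S P [Dphi phi_min] Mphi m_in; split=> // y Dy.
have := phi_min y Dy; rewrite /S Mphi.
move: (M_fin y Dy) (E_ninfty y Dy); rewrite fin_numElt.
case My : (M y) => [n| |]// _; case Ey : (E y) => [b| |]// _; last first.
  by rewrite !addye// => _; rewrite leey.
case Ephi : (E phi) => [e| |]; last 2 first.
- by rewrite addye// -EFinM -EFinD leye_eq.
- by have := E_ninfty phi Dphi; rewrite Ephi.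
rewrite -!EFinM -!EFinD !lee_fin => _.
apply: (@le_of_slack _ (w0 - w) _ _ m P).
  exact: interval_slack.
move=> k [psi [Dpsi psi_min] Mpsi].
have := psi_min y Dy; have := phi_min psi Dpsi.
rewrite /S Mphi Ephi My Ey Mpsi.
case Epsi : (E psi) => [a| |]; last 2 first.
- by move=> _; rewrite addye// -EFinM -EFinD leye_eq.
- by have := E_ninfty psi Dpsi; rewrite Epsi.
rewrite -!EFinM -!EFinD !lee_fin.
exact: action_comparison.
Qed.

Lemma mass_fin_num (R : realType) (d : nat) (V : 'rV[R]_d -> R)
  (phi : 'rV[R]_d -> R[i]) : X V phi -> mass phi \is a fin_num.
Proof.
move=> [[[_ mass_lty] _] _]; rewrite ge0_fin_numE//.
by apply: integral_ge0 => x _; rewrite lee_fin powR_ge0.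
Qed.

Lemma energy_neq_ninfty (R : realType) (d : nat) (d_ge2 : (2 <= d)%N)
    (p : R) (V : 'rV[R]_d -> R) (Omega : R) (phi : 'rV[R]_d -> R[i]) :
  0 <= p + 1 -> (forall x, 0 <= V x) -> energy d_ge2 V Omega p phi != -oo%E.
Proof.
move=> p1_ge0 V_ge0; rewrite /energy -ltNye.
apply: (@lt_le_trans _ _ (0 - (Omega * complex.Re (cintegral
  (fun x => (phi x)^*%C * Lz d_ge2 phi x)))%:E)%E).
  by rewrite add0e -EFinN ltNyr.
rewrite leeD2r//; apply: adde_ge0; first apply: adde_ge0.
- rewrite mule_ge0 ?lee_fin ?invr_ge0// integral_ge0// => x _.
  by rewrite lee_fin sumr_ge0// => j _; rewrite sqr_ge0.
- by apply: integral_ge0 => x _; rewrite lee_fin mulr_ge0 ?sqr_ge0.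
- rewrite mule_ge0 ?lee_fin ?divr_ge0// integral_ge0// => x _.
  by rewrite lee_fin powR_ge0.
Qed.

Theorem theorem4p2 (R : realType) (d : nat) (d_ge2 : (2 <= d)%N)
  (p : R) (p_gt1 : 1 < p)
  (p_subcritical : (3 <= d)%N -> p < (d + 2)%:R / (d - 2)%:R)
  (V : 'rV[R]_d -> R) (V_ge0 : forall x, 0 <= V x)
  (V_infty : V x @[x --> at_infinity] --> +oo)
  (Omega_max_gt0 : (0 < Omega_max d_ge2 V)%E)
  (Omega : R) (Omega_gt0 : 0 < Omega)
  (Omega_lt : (Omega%:E < Omega_max d_ge2 V)%E)
  (omega0 : R) (omega0_lt : (omega0%:E < - lambda0 d_ge2 V Omega)%E)
  (gap : mass_interval d_ge2 V Omega p omega0 `\` masses d_ge2 V Omega p omega0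
         !=set0) :
  forall m : R,
    (mass_interval d_ge2 V Omega p omega0 `\` masses d_ge2 V Omega p omega0) m ->
  forall phi : 'rV[R]_d -> R[i],
    energy_ground_state d_ge2 V Omega p m phi ->
  forall omega : R, ~ action_ground_state d_ge2 V Omega p omega phi.
Proof.
move=> m [m_in m_gap] phi [[Xphi mass_phi] _] omega phi_min.
apply: m_gap; exists phi => //.
apply: (@argmin_transfer R _ (X V) (energy d_ge2 V Omega p) (@mass R d)
  omega omega0 m phi _ _ phi_min mass_phi m_in) => y Xy.
- by apply: energy_neq_ninfty => //; lra.
- exact: mass_fin_num Xy.
Qed.
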